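(* Suppose that a Suslin tree exists. Then there exists a Suslin tree $T$ such that $\mathsf{stat}\text{-}\mathsf{BN}^1_{T,\omega_1}$ fails.
   Context: A Suslin tree is a tree of height $\omega_1$ with no uncountable branches and no uncountable antichains. A tree $T$ is regarded as a forcing with the reversed tree order (higher nodes are stronger conditions); a forcing is a partial order with a largest element. $\mathsf{stat}\text{-}\mathsf{BN}^1_{T,\omega_1}$ states: for every 1-bounded rank 1 $\omega_1$-name $\sigma$, i.e. every set $\sigma$ of pairs $(\check\alpha,p)$ with $\alpha<\omega_1$, $p\in T$ and at most one such $p$ for each $\alpha$, if $T\Vdash$ ''$\sigma$ is stationary in $\omega_1$'', then there is a filter $g\in V$ on $T$ such that $\sigma^g$ is stationary in $\omega_1$ in $V$. Here $V$ is the ground model and $\sigma^g=\{\alpha\mid\exists p\in g\ (\check\alpha,p)\in\sigma\}$. *)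

(* Defs.v *)
From HB Require Import structures.
From mathcomp Require Import all_boot all_order.
From mathcomp Require Import wochoice all_classical.

Set Implicit Arguments.
Unset Strict Implicit.
Unset Printing Implicit Defensive.

Import Order.TTheory.
Local Open Scope classical_set_scope.
Local Open Scope order_scope.

(* W is (a copy of) omega_1, up to isomorphism: elements of W are the countable
   ordinals, and an ordinal is identified with its set of predecessors. *)
Record is_omega1 (d : Order.disp_t) (W : orderType d) : Prop := IsOmega1 {
  omega1_wf : well_founded (fun a b : W => a < b);
  omega1_countable_below : forall a : W, countable [set b : W | b < a];
  omega1_uncountable : ~ countable [set: W]
}.

Section Club.
Context (d : Order.disp_t) (W : orderType d).
Implicit Types (S C : set W) (a b c : W).

Definition unbounded C := forall a, exists2 c, C c & a < c.

(* The two hypotheses on a say that a is a nonzero limit and that C is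
   unbounded in a. *)
Definition closed_in C := forall a,
  (exists b, b < a) ->
  (forall b, b < a -> exists2 c, C c & b < c < a) -> C a.

Definition club C := unbounded C /\ closed_in C.

Definition stationary S := forall C, club C -> exists2 a, S a & C a.

End Club.

Section Suslin.
Context (dW : Order.disp_t) (W : orderType dW).
Context (d : Order.disp_t) (T : porderType d).

Definition is_tree := forall t : T, wo_chain (<=%O : rel T) [pred s | s < t].

(* The set of predecessors of t has order type a. *)
Definition node_height (t : T) (a : W) := exists f : T -> W,
  set_bij [set s | s < t] [set b | b < a] f /\
  (forall s s', s < t -> s' < t -> (f s < f s') = (s < s')).

(* When W is omega_1, this says that the heights of the nodes of T are exactly
   the countable ordinals. *)
Definition tree_height_is :=
  (forall t : T, exists a : W, node_height t a) /\
  (forall a : W, exists t : T, node_height t a).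

Definition is_chain (B : set T) := total_on B (fun s t => s <= t).

Definition is_branch (B : set T) :=
  is_chain B /\ forall B', is_chain B' -> B `<=` B' -> B' = B.

Definition is_antichain (A : set T) :=
  forall s t, A s -> A t -> s != t -> s >< t.

Definition suslin_tree :=
  [/\ is_tree, tree_height_is,
      forall B, is_branch B -> countable B &
      forall A, is_antichain A -> countable A].

End Suslin.

(* P-names: a name is a family of pairs (name, condition). *)
Inductive name (P : Type) : Type :=
  Name (I : Type) (elt : I -> name P) (cond : I -> P).

(* Formulas of the forcing language, i.e. formulas of set theory with names as
   parameters; a quantified formula is given by all its instances. *)
Inductive formula (P : Type) : Type :=
| FMem (x y : name P)
| FEq (x y : name P)
| FNot (phi : formula P)
| FAnd (phi psi : formula P)
| FAll (phi : name P -> formula P).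

Section Formulas.
Context (P : Type).
Implicit Types (phi psi : formula P) (x y S C K : name P).

Definition FImp phi psi := FNot (FAnd phi (FNot psi)).
Definition FEx (phi : name P -> formula P) := FNot (FAll (fun x => FNot (phi x))).
Definition FAllIn y (phi : name P -> formula P) :=
  FAll (fun x => FImp (FMem x y) (phi x)).
Definition FExIn y (phi : name P -> formula P) :=
  FEx (fun x => FAnd (FMem x y) (phi x)).

(* In the formulas below K is a limit ordinal and ordinals are compared by
   membership. *)
Definition FUnbounded C K :=
  FAllIn K (fun a => FExIn C (fun c => FMem a c)).

Definition FClosed C K :=
  FAllIn K (fun a =>
    FImp (FEx (fun b => FMem b a))
    (FImp (FAllIn a (fun b => FExIn C (fun c => FAnd (FMem b c) (FMem c a))))
          (FMem a C))).

Definition FClub C K :=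
  FAnd (FAllIn C (fun c => FMem c K)) (FAnd (FUnbounded C K) (FClosed C K)).

Definition FStationary S K :=
  FAll (fun C => FImp (FClub C K) (FExIn S (fun a => FMem a C))).

End Formulas.

Section Forcing.
Context (d : Order.disp_t) (P : tPOrderType d).
Implicit Types (p q r s : P) (x y : name P).

Definition dense_below (D : set P) p :=
  forall q, q <= p -> exists2 r, r <= q & D r.

(* p forces x = y iff p forces both inclusions; p forces x \subset y iff for
   every (z, s) in x, every q <= p, s forces z \in y. *)
Fixpoint forces_eq x y {struct x} : set P :=
  match x, y with
  | Name _ u a, Name _ v b => fun p =>
      (forall i q, q <= p -> q <= a i ->
         dense_below (fun r => exists2 j, r <= b j & forces_eq (u i) (v j) r) q)
      /\
      (forall j q, q <= p -> q <= b j ->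
         dense_below (fun r => exists2 i, r <= a i & forces_eq (u i) (v j) r) q)
  end.

Definition forces_mem x y : set P :=
  let: Name _ v b := y in
  dense_below (fun r => exists2 j, r <= b j & forces_eq x (v j) r).

Fixpoint forces p (phi : formula P) {struct phi} : Prop :=
  match phi with
  | FMem x y => forces_mem x y p
  | FEq x y => forces_eq x y p
  | FNot phi => forall q, q <= p -> ~ forces q phi
  | FAnd phi psi => forces p phi /\ forces p psi
  | FAll phi => forall x, forces p (phi x)
  end.

Record is_filter (g : set P) : Prop := IsFilter {
  filter_top : g \top;
  filter_up : forall p q, g p -> p <= q -> g q;
  filter_dir : forall p q, g p -> g q -> exists r, [/\ g r, r <= p & r <= q]
}.

Context (dW : Order.disp_t) (W : orderType dW).

(* The canonical name of the ordinal a, by recursion on a. *)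
Fixpoint check_acc (a : W) (h : Acc (fun b c : W => b < c) a) {struct h} :
    name P :=
  Name (fun b : {b : W | b < a} => check_acc (Acc_inv h (svalP b)))
       (fun=> \top).

Context (hW : is_omega1 W).

Definition check (a : W) : name P := check_acc (omega1_wf hW a).

Definition check_omega1 : name P := Name check (fun=> \top).

(* A rank 1 omega_1-name is a set of pairs (check a, p); it is coded by the set
   of the corresponding pairs (a, p). *)
Definition one_bounded (sigma : set (W * P)) :=
  forall a p q, sigma (a, p) -> sigma (a, q) -> p = q.

Definition rank1_name (sigma : set (W * P)) : name P :=
  Name (fun i : {i : W * P | sigma i} => check (sval i).1)
       (fun i => (sval i).2).

Definition eval_at (sigma : set (W * P)) (g : set P) : set W :=
  [set a | exists2 p, g p & sigma (a, p)].

(* P is ordered as a forcing (q <= p: q is stronger than p); a rooted tree T is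
   a forcing through its dual T^d. *)
Definition stat_BN1 : Prop := forall sigma : set (W * P),
  one_bounded sigma ->
  forces \top (FStationary (rank1_name sigma) check_omega1) ->
  exists2 g : set P, is_filter g & stationary (eval_at sigma g).

End Forcing.

Arguments stat_BN1 {d} P {dW W} hW.
Arguments suslin_tree {dW} W {d} T.

(* Main.v *)
Require Import Defs.
From HB Require Import structures.
From mathcomp Require Import all_boot all_order.
From mathcomp Require Import wochoice all_classical.

(** The idea: fix an injective family of nodes x_a, a < omega_1, of a Suslin
    tree T, and let sigma be the name consisting of the pairs (a, x_a).  A filter
    on a tree is a chain, hence countable when the tree is Suslin, and since x is
    injective sigma^g is then countable as well; so no filter of the ground model
    can make sigma^g stationary ([suslin_filter_countable]).  It remains to pass
    to a Suslin subtree in which sigma is forced to be stationary.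

    In a ccc forcing every club of omega_1 of the extension contains a club of the
    ground model ([forces_club_ground]).  Hence sigma is forced to be stationary
    as soon as, for every condition q, the set of those a for which x_a is
    compatible with q is stationary in the ground model ([forces_stationary]).
    So the theorem reduces to finding a node t such that the set of all a with
    s <= x_a is stationary for every s >= t: the cone above t, with t as its
    root, is then the required tree.

    Such a t exists ([stationary_cone]).  Otherwise the nodes s for which the set
    of all a with s <= x_a is nonstationary are cofinal in T.  Take a maximal
    antichain A among them; it is countable, and by maximality every x_a is
    comparable with a node of A.  For a fixed s in A the x_a above s are indexed
    by a nonstationary set, and those below s by a countable set.  So omega_1
    would be a countable union of nonstationary sets.

    The cone above t is again a Suslin tree ([cone_suslin]).  Its nodes have new
    heights, obtained by recursion as strict suprema of the heights below; all
    countable ordinals occur, since otherwise the cone would be a countable union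
    of levels, which are antichains, whereas it contains uncountably many x_a. *)

Set Implicit Arguments.
Unset Strict Implicit.
Unset Printing Implicit Defensive.

Import Order.TTheory.
Local Open Scope classical_set_scope.
Local Open Scope order_scope.

(** * Countable sets *)

Section Countability.
Context (T U : Type).

Lemma countable_image (f : T -> U) (A : set T) : countable A -> countable (f @` A).
Proof. exact/sub_countable/card_image_le. Qed.

Lemma countable_subset (A B : set T) : A `<=` B -> countable B -> countable A.
Proof. by move=> /subset_card_le; exact: sub_countable. Qed.

Lemma countable_preimage (f : T -> U) (A : set T) (B : set U) :
  {in A &, injective f} -> f @` A `<=` B -> countable B -> countable A.
Proof.
by move=> /inj_card_eq/eq_countable <- /subset_card_le; exact: sub_countable.
Qed.

Lemma countableU1 (A : set T) (t : T) : countable A -> countable (A `|` [set t])%classic.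
Proof.
move=> cA; rewrite -bigcup2E; apply: bigcup_countable => // i _.
by rewrite /bigcup2; case: ifP => // _; case: ifP.
Qed.

End Countability.

(** * Clubs and stationary sets of countable ordinals *)

Section Omega1.
Context (d : Order.disp_t) (W : orderType d) (hW : is_omega1 W).
Implicit Types (S C : set W) (a b c : W) (f : W -> W).

Lemma wf_minimum S a : S a -> exists2 m, S m & forall b, S b -> m <= b.
Proof.
elim/(well_founded_ind (omega1_wf hW)): a => a IH Sa.
have [[b Sb ba]|noS] := pselect (exists2 b, S b & b < a); first exact: (IH b).
by exists a => // b Sb; rewrite leNgt; apply/negP => ba; apply: noS; exists b.
Qed.

(** Regularity of omega_1: a cofinal countable set would cover it by countably
    many countable initial segments. *)
Lemma countable_bounded S : countable S -> exists a, forall b, S b -> b < a.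
Proof.
move=> cS; apply: contrapT => unb; apply: (omega1_uncountable hW).
have -> : [set: W] = \bigcup_(s in S) ([set b | b < s] `|` [set s])%classic.
  apply/seteqP; split=> // a _; apply: contrapT => aS; apply: unb.
  exists a => b Sb; rewrite ltNge; apply/negP => ab; apply: aS; exists b => //.
  by move: ab; rewrite le_eqVlt => /orP[/eqP->|]; [right|left].
apply: bigcup_countable => // s _.
exact/countableU1/(omega1_countable_below hW).
Qed.

Lemma countable_le a : countable [set b | b <= a].
Proof.
have [c ac] := countable_bounded (countable1 a).
apply: countable_subset (omega1_countable_below hW c).
by move=> b /= /le_lt_trans; apply; apply: ac.
Qed.

Definition strict_sup S a :=
  (forall b, S b -> b < a) /\ (forall c, (forall b, S b -> b < c) -> a <= c).

Lemma strict_sup_exists S : countable S -> exists a, strict_sup S a.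
Proof.
move=> /countable_bounded[c Sc].
have [a aS amin] := @wf_minimum [set a | forall b, S b -> b < a] c Sc.
by exists a; split.
Qed.

(** Requiring a to be nonzero makes closure points of an inflationary f limits:
    b < a gives b < f b < a. *)
Definition closure_points f : set W :=
  [set a | (exists b, b < a) /\ forall b, b < a -> f b < a].

(** These clubs are the only ones that have to be constructed below.  For
    unboundedness, g c bounds the values of f on all b <= c, and the strict
    supremum of the iterates of g from a is a closure point above a. *)
Lemma closure_points_club f : club (closure_points f).
Proof.
split=> [a|a a_gt0 cof]; last first.
  split=> // b ba; have [c [_ cP] /andP[bc ca]] := cof b ba.
  exact: lt_trans (cP b bc) ca.
have /choice[g gP] : forall c, exists e, c < e /\ forall b, b <= c -> f b < e.
  move=> c.
  have [e eP] := countable_bounded (countable_image f (countable_le c)).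
  have [e' cP] := countable_bounded (countable1 c).
  exists (Order.max e e'); rewrite lt_max cP ?orbT//; split=> // b bc.
  by rewrite lt_max eP//; exists b.
pose u n := iter n g a.
have [c [uc cmin]] := strict_sup_exists (countable_image u (countableP setT)).
have {}uc n : u n < c by apply: uc; exists n.
have uS n : u n.+1 = g (u n) by [].
exists c; last exact: (uc 0).
split=> [|b bc]; first by exists a; apply: (uc 0).
have [n bn] : exists n, b <= u n.
  apply: contrapT => nb; move: bc; apply/negP; rewrite -leNgt.
  apply: cmin => _ [n _ <-]; rewrite ltNge; apply/negP => bn.
  by apply: nb; exists n.
by have [_ /(_ _ bn)/lt_trans] := gP (u n); rewrite -uS; apply.
Qed.

(** The closure points of the constant function a form a club above a. *)
Lemma stationary_unbounded S : stationary S -> unbounded S.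
Proof.
move=> statS a; have [c Sc [[b bc] /(_ b bc) ac]] :=
  statS _ (closure_points_club (fun=> a)).
by exists c.
Qed.

Lemma stationary_uncountable S : stationary S -> ~ countable S.
Proof.
move=> /stationary_unbounded unbS /countable_bounded[a Sa].
by have [c /Sa ca /(lt_trans ca)] := unbS a; rewrite ltxx.
Qed.

(** Each N i misses a club C i.  Let f b bound, for all i simultaneously, some
    element of C i above b: a closure point of f is a limit of elements of every
    C i, so the club of closure points misses the whole union. *)
Lemma nonstationary_bigcup (I : Type) (D : set I) (N : I -> set W) :
  countable D -> (forall i, D i -> ~ stationary (N i)) ->
  ~ stationary (\bigcup_(i in D) N i).
Proof.
move=> cD nN statU.
have /choice[C CP] : forall i, exists C,
    D i -> club C /\ forall a, N i a -> ~ C a.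
  move=> i; have [Di|] := pselect (D i); last by exists setT.
  apply: contrapT => nC; apply: (nN _ Di) => C cC; apply: contrapT => NC.
  by apply: nC; exists C => _; split=> // a Na Ca; apply: NC; exists a.
have /choice[f fP] : forall b, exists e, forall i, D i ->
    exists2 c, C i c & b < c < e.
  move=> b; have /choice[g gP] : forall i, exists c, D i -> C i c /\ b < c.
    move=> i; have [Di|] := pselect (D i); last by exists b.
    by have [[/(_ b)[c Cc bc] _] _] := CP _ Di; exists c.
  have [e eP] := countable_bounded (countable_image g cD).
  exists e => i Di; have [Cg bg] := gP _ Di; exists (g i) => //.
  by rewrite bg eP//; exists i.
have [a [i Di Na] [a0 fa]] := statU _ (closure_points_club f).
have [[_ clC] disj] := CP _ Di; apply: (disj a Na); apply: clC => // b ba.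
have [c Cc /andP[bc cf]] := fP b i Di; exists c => //.
by rewrite bc (lt_trans cf)// fa.
Qed.

End Omega1.

(** For comparability in a tree and for compatibility in a forcing this yields
    maximal antichains inside X. *)
Lemma maximal_independent (T : Type) (R : T -> T -> Prop) (X : set T) :
  (forall s, R s s) -> (forall s t, R s t -> R t s) ->
  exists A : set T, [/\ A `<=` X,
    forall s t, A s -> A t -> R s t -> s = t &
    forall x, X x -> exists2 a, A a & R x a].
Proof.
move=> Rxx Rsym.
pose ind (A : set T) := A `<=` X /\ forall s t, A s -> A t -> R s t -> s = t.
have [|A [[AX Aind] Amax]] := @Zorn_bigcup T ind.
  move=> F Find Ftot; split=> [s [A /Find[AX _] /AX]//|s t [A FA As] [B FB Bt]].
  have [AB|BA] := Ftot A B FA FB.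
    by have [_] := Find _ FB; apply => //; apply: AB.
  by have [_] := Find _ FA; apply => //; apply: BA.
exists A; split=> // x Xx; apply: contrapT => xA.
have {}xA a : A a -> ~ R x a by move=> Aa Rxa; apply: xA; exists a.
apply: (Amax (A `|` [set x])%classic).
  split; last by move=> /(_ x (or_intror erefl))/xA/(_ (Rxx x)).
  by left.
split=> [s [/AX//|->//]|s t [As|->] [At|->]//]; first exact: Aind.
  by move=> /Rsym/xA-/(_ As).
by move=> /xA-/(_ At).
Qed.

(** * The forcing relation *)

Section ForcingBasics.
Context (d : Order.disp_t) (P : tPOrderType d).
Implicit Types (p q r : P) (x y z : name P) (phi psi : formula P).

Lemma forces_eq_mono x y p q : q <= p -> forces_eq x y p -> forces_eq x y q.
Proof.
case: x => I u a; case: y => J v b /= qp [xy yx].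
by split=> i r rq; [apply: xy|apply: yx]; apply: le_trans rq qp.
Qed.

Lemma forces_mem_mono x y p q : q <= p -> forces_mem x y p -> forces_mem x y q.
Proof. by case: y => J v b /= qp xy r rq; apply: xy; apply: le_trans rq qp. Qed.

Lemma forces_eq_refl x p : forces_eq x x p.
Proof.
elim: x p => I u IH a p /=; split=> i q _ qi r rq;
  by exists r => //; exists i => //; apply: le_trans rq qi.
Qed.

Lemma forces_eq_sym x y p : forces_eq x y p -> forces_eq y x p.
Proof.
elim: x y p => I u IH a [J v b] p /= [xy yx].
split=> [j q qp qj r rq|i q qp qi r rq].
  have [s sr [i si /IH vu]] := yx j q qp qj r rq.
  by exists s => //; exists i.
have [s sr [j sj /IH vu]] := xy i q qp qi r rq.
by exists s => //; exists j.
Qed.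

Lemma forces_eq_trans x y z p :
  forces_eq x y p -> forces_eq y z p -> forces_eq x z p.
Proof.
elim: x y z p => I u IH a [J v b] [K w c] p /= [xy yx] [yz zy].
split=> [i q qp qi r rq|k q qp qk r rq].
  have [s sr [j sj uv]] := xy i q qp qi r rq.
  have sp : s <= p by rewrite (le_trans sr)// (le_trans rq).
  have [t ts [k tk vw]] := yz j s sp sj s (lexx s).
  exists t; first exact: le_trans ts sr.
  by exists k => //; apply: IH vw; apply: forces_eq_mono uv.
have [s sr [j sj vw]] := zy k q qp qk r rq.
have sp : s <= p by rewrite (le_trans sr)// (le_trans rq).
have [t ts [i ti uv]] := yx j s sp sj s (lexx s).
exists t; first exact: le_trans ts sr.
by exists i => //; apply: IH uv _; apply: forces_eq_mono vw.
Qed.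

Lemma forces_mem_eql x x' y p :
  forces_eq x x' p -> forces_mem x y p -> forces_mem x' y p.
Proof.
case: y => J v b /= xx' xy q qp; have [r rq [j rj xv]] := xy q qp.
exists r => //; exists j => //; apply: forces_eq_trans xv.
by apply: forces_eq_sym; apply: forces_eq_mono xx'; apply: le_trans rq qp.
Qed.

Lemma forces_mem_eqr x y y' p :
  forces_eq y y' p -> forces_mem x y p -> forces_mem x y' p.
Proof.
case: y => J v b; case: y' => K w c /= [yy' _] xy q qp.
have [r rq [j rj xv]] := xy q qp.
have [s sr [k sk vw]] := yy' j r (le_trans rq qp) rj r (lexx r).
exists s; first exact: le_trans sr rq.
by exists k => //; apply: forces_eq_trans vw; apply: forces_eq_mono xv.
Qed.

(** The connectives other than negation, conjunction and universal quantification
    are abbreviations; these introduction and elimination rules replace the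
    unfolding of their double negations by density statements. *)
Lemma forces_ImpE p phi psi : forces p (FImp phi psi) ->
  forall q, q <= p -> forces q phi -> exists2 r, r <= q & forces r psi.
Proof.
move=> /= imp q qp qphi; apply: contrapT => nr; apply: (imp q qp); split=> // r rq.
by move=> rpsi; apply: nr; exists r.
Qed.

Lemma forces_ImpI p phi psi :
  (forall q, q <= p -> forces q phi -> exists2 r, r <= q & forces r psi) ->
  forces p (FImp phi psi).
Proof. by move=> /= imp q qp [qphi npsi]; have [r /npsi] := imp q qp qphi. Qed.

Lemma forces_ExE p (phi : name P -> formula P) : forces p (FEx phi) ->
  forall q, q <= p -> exists2 r, r <= q & exists x, forces r (phi x).
Proof.
move=> /= ex q qp; apply: contrapT => nr; apply: (ex q qp) => x r rq rphi.
by apply: nr; exists r => //; exists x.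
Qed.

Lemma forces_ExI p (phi : name P -> formula P) :
  (forall q, q <= p -> exists2 r, r <= q & exists x, forces r (phi x)) ->
  forces p (FEx phi).
Proof. by move=> /= ex q qp nphi; have [r /nphi nr [x /nr]] := ex q qp. Qed.

Lemma forces_AllI p (phi : name P -> formula P) :
  (forall x, forces p (phi x)) -> forces p (FAll phi).
Proof. by []. Qed.

Lemma forces_AllInE p y (phi : name P -> formula P) : forces p (FAllIn y phi) ->
  forall x q, q <= p -> forces_mem x y q -> exists2 r, r <= q & forces r (phi x).
Proof. by move=> all x; exact: (@forces_ImpE p (FMem x y) (phi x) (all x)). Qed.

Lemma forces_AllInI p y (phi : name P -> formula P) :
  (forall x q, q <= p -> forces_mem x y q ->
    exists2 r, r <= q & forces r (phi x)) ->
  forces p (FAllIn y phi).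
Proof. by move=> all; apply: forces_AllI => x; apply: forces_ImpI => q; exact: all. Qed.

Lemma forces_ExInE p y (phi : name P -> formula P) : forces p (FExIn y phi) ->
  forall q, q <= p ->
  exists2 r, r <= q & exists2 x, forces_mem x y r & forces r (phi x).
Proof.
move=> ex q qp; have [r rq [x [xy phix]]] := forces_ExE ex qp.
by exists r => //; exists x.
Qed.

Lemma forces_ExInI p y (phi : name P -> formula P) :
  (forall q, q <= p ->
    exists2 r, r <= q & exists2 x, forces_mem x y r & forces r (phi x)) ->
  forces p (FExIn y phi).
Proof.
move=> ex; apply: forces_ExI => q /ex[r rq [x xy phix]].
by exists r => //; exists x; split.
Qed.

Lemma forces_ClubE p C K : forces p (FClub C K) ->
  [/\ forces p (FAllIn C (fun c => FMem c K)), forces p (FUnbounded C K) &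
      forces p (FClosed C K)].
Proof. by case=> CK [unbC clC]. Qed.

Context (dW : Order.disp_t) (W : orderType dW) (hW : is_omega1 W).
Implicit Types (a b c : W).
Notation check := (check P hW).

(** Proofs of accessibility are equal, so the recursion may be restarted from the
    canonical proof at each predecessor. *)
Lemma checkE a :
  check a = Name (fun b : {b : W | b < a} => check (sval b)) (fun=> \top).
Proof.
rewrite /Defs.check; case: (omega1_wf hW a) => h /=; congr Name.
by apply/funext => b; congr check_acc; apply: Prop_irrelevance.
Qed.

Lemma forces_check_mem a b p : a < b -> forces_mem (check a) (check b) p.
Proof.
move=> ab; rewrite (checkE b) => q qp; exists q => //.
by exists (exist (fun a => a < b) a ab); [exact: lex1|exact: forces_eq_refl].
Qed.

Lemma forces_mem_checkE x b p : forces_mem x (check b) p ->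
  forall q, q <= p ->
  exists2 r, r <= q & exists2 a, a < b & forces_eq x (check a) r.
Proof.
rewrite (checkE b) => xb q qp; have [r rq [[a ab] _ xa]] := xb q qp.
by exists r => //; exists a.
Qed.

(** Absoluteness of the order of omega_1, by induction on a: were b < a, then b
    would be forced to belong to itself, so that some c < b would be forced equal
    to b, contradicting the induction hypothesis at b; were a < b, then a would
    be forced equal to some c < a, which is excluded at c. *)
Lemma forces_check_eqE a b p : forces_eq (check a) (check b) p -> a = b.
Proof.
elim/(well_founded_ind (omega1_wf hW)): a b p => a IH b p ab.
have inj c e q : c < a -> forces_eq (check c) (check e) q -> c = e.
  by move=> ca; apply: IH.
apply/eqP; rewrite eq_le !leNgt; apply/andP; split; apply/negP => lt_ab.
  have /forces_mem_checkE/(_ p (lexx p))[r _ [c cb bc]] :=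
    forces_mem_eqr ab (forces_check_mem p lt_ab).
  by have cE := inj b c r lt_ab bc; move: cb; rewrite cE ltxx.
have /forces_mem_checkE/(_ p (lexx p))[r _ [c ca ac]] :=
  forces_mem_eqr (forces_eq_sym ab) (forces_check_mem p lt_ab).
have cE := inj c a r ca (forces_eq_sym ac).
by move: ca; rewrite cE ltxx.
Qed.

Lemma forces_check_memE a b p : forces_mem (check a) (check b) p -> a < b.
Proof.
move=> /forces_mem_checkE/(_ p (lexx p))[r _ [c cb /forces_check_eqE->]].
exact: cb.
Qed.

Lemma forces_check_mem_omega1 a p : forces_mem (check a) (check_omega1 P hW) p.
Proof.
move=> q qp; exists q => //.
by exists a; [exact: lex1|exact: forces_eq_refl].
Qed.

End ForcingBasics.

Arguments forces_check_mem_omega1 {d P dW W} hW a p.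

(** * Names forced to be stationary *)

Section ForcingStationary.
Context (d : Order.disp_t) (P : tPOrderType d).
Context (dW : Order.disp_t) (W : orderType dW) (hW : is_omega1 W).
Implicit Types (p q r : P) (C : name P) (a b c : W).
Notation check := (check P hW).
Notation K := (check_omega1 P hW).

Definition compatible p q := exists r, r <= p /\ r <= q.

Hypothesis ccc : forall A : set P,
  (forall p q, A p -> A q -> compatible p q -> p = q) -> countable A.

(** The formula provides arbitrary names for an element of C; since C is forced to
    consist of countable ordinals, each can be decided to be a check a. *)
Lemma forces_unboundedE C q : forces q (FClub C K) ->
  forall b p, p <= q -> exists2 r, r <= p &
    exists2 c, b < c & forces_mem (check c) C r.
Proof.
case/forces_ClubE=> CK unbC _ b p pq.
have [p1 p1p ex] := forces_AllInE unbC pq (forces_check_mem_omega1 hW b p).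
have [p2 p21 [x xC bx]] := forces_ExInE ex (lexx p1).
have p2q : p2 <= q by rewrite (le_trans p21)// (le_trans p1p).
have [p3 p32 xK] := forces_AllInE CK p2q xC.
have [r r3 [c _ xc]] := xK p3 (lexx p3).
have r2 := le_trans r3 p32.
exists r; first by rewrite (le_trans r2)// (le_trans p21).
exists c; last by apply: forces_mem_eql xc _; apply: forces_mem_mono xC.
apply: (@forces_check_memE _ _ _ _ hW _ _ r).
by apply: forces_mem_eqr xc _; apply: forces_mem_mono bx.
Qed.

(** Here the chain condition is used: among the conditions that decide an element
    of C above b, a maximal set of pairwise incompatible ones is countable, so the
    elements decided by it are bounded by some e. *)
Lemma forces_club_bound C q : forces q (FClub C K) ->
  forall b, exists e, forall p, p <= q -> exists2 r, r <= p &
    exists2 c, b < c < e & forces_mem (check c) C r.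
Proof.
move=> qC b.
pose X := [set r | exists2 c, b < c & forces_mem (check c) C r].
have [|p q' [r [rp rq]]|A [AX /ccc cA Amax]] := @maximal_independent _ compatible X.
- by move=> p; exists p.
- by exists r.
have /choice[h hP] : forall r, exists c, A r -> b < c /\ forces_mem (check c) C r.
  move=> r; have [/AX[c bc cC]|] := pselect (A r); first by exists c.
  by exists b.
have [e eP] := countable_bounded hW (countable_image h cA).
exists e => p pq; have [r rp Xr] := forces_unboundedE qC b pq.
have [s As [t [tr ts]]] := Amax r Xr; have [bs sC] := hP s As.
exists t; first exact: le_trans tr rp.
exists (h s); last exact: forces_mem_mono sC.
by rewrite bs eP//; exists s.
Qed.

(** The cofinality hypothesis says that q forces C to be unbounded in a. *)
Lemma forces_closedE C q a : forces q (FClub C K) -> (exists b, b < a) ->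
  (forall b, b < a -> forall p, p <= q -> exists2 r, r <= p &
    exists2 c, b < c < a & forces_mem (check c) C r) ->
  forall p, p <= q -> exists2 r, r <= p & forces_mem (check a) C r.
Proof.
case/forces_ClubE=> _ _ clC [b0 b0a] cof p pq.
have [p1 p1p imp] := forces_AllInE clC pq (forces_check_mem_omega1 hW a p).
have [|p2 p21 imp2] := forces_ImpE imp (lexx p1).
  apply: forces_ExI => r _; exists r => //; exists (check b0).
  exact: forces_check_mem.
have [|p3 p32 aC] := forces_ImpE imp2 (lexx p2); last first.
  by exists p3 => //; rewrite (le_trans p32)// (le_trans p21).
apply: forces_AllInI => y r r2 ya.
have [s sr [b ba yb]] := forces_mem_checkE ya (lexx r).
exists s => //; apply: forces_ExInI => t ts.
have tq : t <= q.
  by rewrite (le_trans ts)// (le_trans sr)// (le_trans r2)// (le_trans p21)//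
    (le_trans p1p).
have [u ut [c /andP[bc ca] cC]] := cof b ba t tq.
exists u => //; exists (check c) => //; split; last exact: forces_check_mem.
apply: forces_mem_eql (forces_check_mem hW u bc).
by apply: forces_eq_sym; apply: forces_eq_mono yb; apply: le_trans ut ts.
Qed.

(** The ground-model club is the set of closure points of the function b |-> e of
    the previous bound: there C is forced to be unbounded. *)
Lemma forces_club_ground C q : forces q (FClub C K) -> exists2 D : set W,
  club D & forall a, D a -> forall p, p <= q ->
    exists2 r, r <= p & forces_mem (check a) C r.
Proof.
move=> qC; have /choice[f fP] := forces_club_bound qC.
exists (closure_points f); first exact: closure_points_club.
move=> a [a0 fa]; apply: (forces_closedE qC a0) => b ba p pq.
have [r rp [c /andP[bc cf] cC]] := fP b p pq; exists r => //; exists c => //.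
by rewrite bc (lt_trans cf)// fa.
Qed.

Lemma forces_stationary (sigma : set (W * P)) :
  (forall q, stationary [set a | exists2 p, sigma (a, p) & compatible p q]) ->
  forces \top (FStationary (rank1_name hW sigma) K).
Proof.
move=> stat; apply: forces_AllI => C; apply: forces_ImpI => q _ qC.
have [D cD DC] := forces_club_ground qC.
have [a [p ap [r [rp rq]]] Da] := stat q D cD.
have [s sr aC] := DC a Da r rq.
exists s; first exact: le_trans sr rq.
apply: forces_ExInI => t ts; exists t => //; exists (check a).
  move=> u ut; exists u => //.
  exists (exist _ (a, p) ap); last exact: forces_eq_refl.
  by rewrite /= (le_trans ut)// (le_trans ts)// (le_trans sr).
exact: forces_mem_mono aC.
Qed.

End ForcingStationary.

(** * Trees and the heights of their nodes *)

Section Trees.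
Context (d : Order.disp_t) (T : porderType d).
Implicit Types (s t u : T) (S : set T).

Lemma is_treeP : is_tree T <->
  forall t S, S !=set0 -> (forall s, S s -> s < t) ->
    exists2 m, S m & forall s, S s -> m <= s.
Proof.
split=> [tree t S [s0 Ss0] St|min t].
  have [||m [[]]] := tree t [pred s | `[< S s >]].
  - by move=> s /asboolP/St.
  - by exists s0; apply/asboolP.
  by move=> /asboolP Sm mlb _; exists m => // s Ss; apply: mlb; apply/asboolP.
move=> A At [s0 As0].
have [||m Am mlb] := min t [set s | s \in A]; first by exists s0.
  by move=> s /At.
exists m; split; first by split=> // s /mlb.
by move=> m' [Am' m'lb]; apply/le_anti; rewrite mlb// m'lb.
Qed.

Hypothesis tree : is_tree T.

Lemma tree_lt_comparable t s u : s < t -> u < t -> s >=< u.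
Proof.
move=> st ut; have [|v [->|->]|m [->|->] mlb] := is_treeP.1 tree t [set s; u].
- by exists s; left.
- exact: st.
- exact: ut.
- by rewrite /Order.comparable mlb//; right.
- by rewrite /Order.comparable [u <= s]mlb ?orbT//; left.
Qed.

Lemma tree_comparable t s u : s <= t -> u <= t -> s >=< u.
Proof.
rewrite le_eqVlt => /orP[/eqP->|st]; first by move=> /ge_comparable.
rewrite le_eqVlt => /orP[/eqP->|]; first exact/le_comparable/ltW.
exact: tree_lt_comparable.
Qed.

Lemma tree_wf : well_founded (fun s t : T => s < t).
Proof.
move=> t; apply: contrapT => nacc.
have bad u : ~ Acc (fun s t : T => s < t) u ->
    exists2 s, s < u & ~ Acc (fun s t : T => s < t) s.
  move=> nu; apply: contrapT => noS; apply: nu; constructor => s su.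
  by apply: contrapT => ns; apply: noS; exists s.
have [|s [_ st]|m [mbad mt] mlb] := is_treeP.1 tree t
  [set s | ~ Acc (fun s t : T => s < t) s /\ s < t].
- by have [s st ns] := bad t nacc; exists s.
- exact: st.
have [s sm ns] := bad m mbad.
by move: (sm); rewrite lt_leAnge mlb ?andbF//; split=> //; apply: lt_trans sm mt.
Qed.

End Trees.

Section Rank.
Context (dW : Order.disp_t) (W : orderType dW) (hW : is_omega1 W).
Context (d : Order.disp_t) (T : porderType d).
Implicit Types (s t u : T) (a b : W).

(** A recursive description of the height function, which is much easier to
    construct than the isomorphisms witnessing heights. *)
Definition is_rank (rk : T -> W) :=
  forall t, strict_sup (rk @` [set s | s < t]) (rk t).

Lemma rank_exists : is_tree T -> (forall t, countable [set s | s < t]) ->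
  exists rk, is_rank rk.
Proof.
move=> tree ctb.
have /choice[sup supP] : forall S : set W, exists a, countable S -> strict_sup S a.
  move=> S; have [cS|] := pselect (countable S).
    by have [a] := strict_sup_exists hW cS; exists a.
  by have [a _] := countable_bounded hW (@countable0 W); exists a.
pose F t (rec : forall s, s < t -> W) := sup [set a | exists s h, a = rec s h].
exists (Fix (tree_wf tree) (fun=> W) F) => t; rewrite Fix_eq.
  have -> : F t (fun s _ => Fix (tree_wf tree) (fun=> W) F s) =
      sup (Fix (tree_wf tree) (fun=> W) F @` [set s | s < t]).
    congr sup; apply/seteqP; split=> [a [s [st ->]]|a [s st <-]]; last by exists s, st.
    by exists s.
  exact/supP/countable_image/ctb.
move=> u f g fg; congr sup; apply/seteqP; split=> a [s [h ->]]; exists s, h => //.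
Qed.

Variable rk : T -> W.
Hypotheses (tree : is_tree T) (rkP : is_rank rk).

Lemma rank_lt s t : s < t -> rk s < rk t.
Proof. by move=> st; have [+ _] := rkP t; apply; exists s. Qed.

Lemma rank_onto t b : b < rk t -> exists2 s, s < t & rk s = b.
Proof.
elim/(well_founded_ind (tree_wf tree)): t => t IH bt.
have [s st] : exists2 s, s < t & b <= rk s.
  apply: contrapT => nos; move: bt; apply/negP; rewrite -leNgt.
  have [_ ] := rkP t; apply=> _ [s st <-]; rewrite ltNge; apply/negP => bs.
  by apply: nos; exists s.
rewrite le_eqVlt => /orP[/eqP->|/(IH s st)[u us ub]]; first by exists s.
by exists u => //; apply: lt_trans us st.
Qed.

Lemma node_height_rank t : node_height t (rk t).
Proof.
have lt_rk s u : s < t -> u < t -> (rk s < rk u) = (s < u).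
  move=> st ut; apply/idP/idP; last exact: rank_lt.
  apply: contraTT => nsu; rewrite -leNgt.
  have := tree_lt_comparable tree st ut; rewrite /Order.comparable.
  rewrite le_eqVlt (negPf nsu) orbF => /orP[/eqP->//|].
  by rewrite le_eqVlt => /orP[/eqP->//|/rank_lt/ltW].
exists rk; split=> //; split=> [s /rank_lt//|s u|b /rank_onto[s]]; last by exists s.
rewrite !inE /= => st ut rksu; apply/eqP; case: eqP => // /eqP nsu.
have : (s < u) || (u < s).
  have := tree_lt_comparable tree st ut.
  by rewrite /Order.comparable !le_eqVlt (eq_sym u) (negPf nsu).
by move=> /orP[]/rank_lt; rewrite rksu ltxx.
Qed.

(** An isomorphism from the predecessors of t to the predecessors of a agrees with
    rk, by induction below t. *)
Lemma rank_unique t a : node_height t a -> rk t = a.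
Proof.
move=> [f [[ffun finj fsurj] fmono]].
have frk s : s < t -> rk s = f s.
  elim/(well_founded_ind (tree_wf tree)): s => s IH st.
  have [lub glb] := rkP s.
  apply/eqP; rewrite eq_le; apply/andP; split.
    by apply: glb => _ [u us <-]; rewrite IH ?fmono// ?(lt_trans us).
  rewrite leNgt; apply/negP => rkf.
  have [|u ut uE] := fsurj (rk s); first exact: lt_trans rkf (ffun s st).
  have us : u < s by rewrite -fmono// uE.
  by have := rank_lt us; rewrite IH// uE ltxx.
have [lub glb] := rkP t.
apply/eqP; rewrite eq_le; apply/andP; split.
  by apply: glb => _ [s st <-]; rewrite frk//; apply: ffun.
rewrite leNgt; apply/negP => /[dup] ta /fsurj[s st sE].
by have := rank_lt st; rewrite frk// sE ltxx.
Qed.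

(** Were a not a rank, all ranks would be below a, because ranks form an initial
    segment; then T would be the union of its levels of rank b < a, which are
    countably many antichains. *)
Lemma tree_height_omega1 : ~ countable [set: T] ->
  (forall A : set T, is_antichain A -> countable A) -> tree_height_is W T.
Proof.
move=> unc ac; split=> [t|a]; first by exists (rk t); exact: node_height_rank.
suff [t <-] : exists t, rk t = a by exists t; exact: node_height_rank.
apply: contrapT => noa; apply: unc.
apply: (@countable_subset _ _ (\bigcup_(b in [set b | b < a]) [set t | rk t = b])).
  move=> t _; exists (rk t) => //=; rewrite ltNge; apply/negP.
  rewrite le_eqVlt => /orP[/eqP/esym ta|/rank_onto[s _ sa]]; apply: noa.
    by exists t.
  by exists s.
apply: bigcup_countable => [|b _]; first exact: omega1_countable_below.
apply: ac => s t /= sb tb nst; apply/negP; rewrite /Order.comparable.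
rewrite !le_eqVlt (eq_sym t) (negPf nst) /=.
by move=> /orP[]/rank_lt; rewrite sb tb ltxx.
Qed.

End Rank.

(** * Suslin trees *)

Section SuslinTrees.
Context (dW : Order.disp_t) (W : orderType dW) (hW : is_omega1 W).
Context (d : Order.disp_t) (T : porderType d).
Hypothesis suslinT : suslin_tree W T.
Implicit Types (s t u : T) (a b : W).

Lemma suslin_countable_lt t : countable [set s | s < t].
Proof.
have [_ [/(_ t)[a [f [[ffun finj _] _]]] _] _ _] := suslinT.
apply: countable_preimage finj _ (omega1_countable_below hW a).
by move=> _ [s st <-]; exact: ffun.
Qed.

Lemma suslin_countable_le t : countable [set s | s <= t].
Proof.
apply: (@countable_subset _ _ ([set s | s < t] `|` [set t])%classic).
  by move=> s /=; rewrite le_eqVlt => /orP[/eqP|]; [right|left].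
exact/countableU1/suslin_countable_lt.
Qed.

(** Choose a node of each height; heights are unique. *)
Lemma suslin_nodes : exists x : W -> T, injective x.
Proof.
have [tree [_ /choice[x xP]] _ _] := suslinT.
have [rk rkP] := rank_exists hW tree suslin_countable_lt.
exists x => a b xab.
by rewrite -(rank_unique tree rkP (xP a)) xab (rank_unique tree rkP (xP b)).
Qed.

(** Either the chain lies below a node, or its downward closure is a maximal
    chain: a node comparable with all its elements and outside it would be an
    upper bound of the chain. *)
Lemma suslin_countable_chain (B : set T) : is_chain B -> countable B.
Proof.
move=> chB; have [tree _ cbr _] := suslinT.
have [[t Bt]|noub] := pselect (exists t, forall s, B s -> s <= t).
  exact: countable_subset Bt (suslin_countable_le t).
pose D := [set s | exists2 u, B u & s <= u].
have BD : B `<=` D by move=> s Bs; exists s.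
apply: (countable_subset BD); apply: cbr; split=> [s u [s' Bs ss'] [u' Bu uu']|].
  apply/orP; have [su|us] := chB s' u' Bs Bu.
    exact: (tree_comparable tree (le_trans ss' su) uu').
  exact: (tree_comparable tree ss' (le_trans uu' us)).
move=> E chE DE; apply/seteqP; split=> // t Et.
apply: contrapT => nDt; apply: noub; exists t => s Bs.
have [//|ts] := chE s t (DE s (BD s Bs)) Et.
by case: nDt; exists s.
Qed.

(** Were the nodes s with nonstationary set of a such that s <= x_a cofinal, a
    maximal antichain A of them would be countable and every x_a comparable with
    a node of A, making omega_1 a countable union of nonstationary sets. *)
Lemma stationary_cone (x : W -> T) : injective x ->
  exists t, forall s, t <= s -> stationary [set a | s <= x a].
Proof.
move=> xinj; apply: contrapT => nostat; have [tree _ _ ac] := suslinT.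
pose N s := [set a | s >=< x a].
pose X := [set s | ~ stationary [set a | s <= x a]].
have NX s : X s -> ~ stationary (N s).
  move=> Xs.
  (* The nodes comparable with s are those above s and those below s; the latter
     are countably many, hence met by countably many x a. *)
  pose M (i : bool) := if i then [set a | s <= x a] else [set a | x a <= s].
  have nM : ~ stationary (\bigcup_(i in [set: bool]) M i).
    apply: (nonstationary_bigcup hW) => // -[] _ //=.
    move=> /(stationary_uncountable hW); apply.
    apply: countable_preimage (in2W xinj) _ (suslin_countable_le s).
    by move=> _ [a xa <-].
  move=> statN; apply: nM => C /statN[a sa Ca]; exists a => //.
  by case/orP: sa; [exists true|exists false].
have [||A [AX Aac Amax]] := @maximal_independent T (fun s t => s >=< t) X.
- by move=> s; exact: comparablexx.
- by move=> s t; rewrite comparable_sym.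
have cA : countable A.
  by apply: ac => s t As At; apply: contra_neqN; exact: Aac.
apply: (@nonstationary_bigcup _ _ hW _ A N cA) => [s /AX/NX//|C [unbC _]].
have [b _] := countable_bounded hW (@countable0 W).
have [a Ca _] := unbC b; exists a => //.
have [s xs Xs] : exists2 s, x a <= s & X s.
  apply: contrapT => nos; apply: nostat; exists (x a) => s xs.
  by apply: contrapT => Xs; apply: nos; exists s.
have [u Au /orP[su|us]] := Amax s Xs; exists u => //.
  exact/ge_comparable/(le_trans xs su).
exact: (tree_comparable tree us xs).
Qed.

End SuslinTrees.

(** * Cones of Suslin trees *)

Section Cone.
Context (d : Order.disp_t) (T : porderType d) (t : T).

(** The cone has to be a type of its own, with t as bottom element, for its dual
    to be a forcing. *)
Definition cone := {s : T | t <= s}.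

HB.instance Definition _ := SubChoice.copy cone {s : T | t <= s}.
HB.instance Definition _ := [SubChoice_isSubPOrder of cone by <: with d].

Definition cone_root : cone := exist _ t (lexx t).

Lemma cone_root_le (s : cone) : cone_root <= s.
Proof. exact: (valP s). Qed.

HB.instance Definition _ := Order.hasBottom.Build d cone cone_root_le.

Lemma cone_is_tree : is_tree T -> is_tree cone.
Proof.
move=> /is_treeP tree; apply/is_treeP => u S [s0 Ss0] Su.
have [||_ [m Sm <-] mlb] := tree (val u) (val @` S).
- by exists (val s0); exists s0.
- by move=> _ [s Ss <-]; exact: Su.
by exists m => // s Ss; apply: mlb; exists s.
Qed.

Lemma cone_antichain (A : set cone) : is_antichain A ->
  is_antichain (val @` A).
Proof. by move=> acA _ _ [s As <-] [u Au <-]; exact: acA. Qed.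

Lemma cone_chain (B : set cone) : is_chain B -> is_chain (val @` B).
Proof. by move=> chB _ _ [s Bs <-] [u Bu <-]; exact: chB. Qed.

End Cone.

Arguments cone {d T} t.

Section SuslinCone.
Context (dW : Order.disp_t) (W : orderType dW) (hW : is_omega1 W).
Context (d : Order.disp_t) (T : porderType d) (t : T).

Lemma cone_suslin : suslin_tree W T -> ~ countable [set s | t <= s] ->
  suslin_tree W (cone t).
Proof.
move=> suslinT unc; have [tree _ _ ac] := suslinT.
have countable_val (A : set (cone t)) : countable (val @` A) -> countable A.
  exact: countable_preimage (in2W val_inj) _.
have acC (A : set (cone t)) : is_antichain A -> countable A.
  by move=> /cone_antichain/ac; exact: countable_val.
have treeC := cone_is_tree (t := t) tree.
split=> // [|B [/cone_chain/(suslin_countable_chain hW suslinT) cB _]].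
  have [u|rk rkP] := rank_exists hW treeC.
    apply: countable_val; apply: countable_subset (suslin_countable_lt hW suslinT (val u)).
    by move=> _ [s su <-].
  apply: (tree_height_omega1 hW treeC rkP) => // cC; apply: unc.
  apply: countable_subset (countable_image val cC) => s ts.
  by exists (exist _ s ts).
exact: countable_val.
Qed.

End SuslinCone.

(** * Suslin trees as forcings *)

Section SuslinForcing.
Context (dW : Order.disp_t) (W : orderType dW) (hW : is_omega1 W).
Context (d : Order.disp_t) (T : bPOrderType d).
Hypothesis suslinT : suslin_tree W T.

Lemma suslin_ccc (A : set (T^d)%type) :
  (forall p q, A p -> A q -> compatible p q -> p = q) -> countable A.
Proof.
move=> Aind; have [_ _ _ ac] := suslinT; apply: (ac A) => s u As Au.
apply: contra_neqN => /orP[su|us]; apply: Aind => //.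
  by exists (u : (T^d)%type); split; [exact: su|exact: lexx].
by exists (s : (T^d)%type); split; [exact: lexx|exact: us].
Qed.

(** Elements of a filter have a common extension, below which the tree is linearly
    ordered: a filter is a chain. *)
Lemma suslin_filter_countable (g : set (T^d)%type) : is_filter g -> countable g.
Proof.
move=> [_ _ dir]; have [tree _ _ _] := suslinT.
apply: (suslin_countable_chain hW suslinT) => s u gs gu; apply/orP.
by have [r [_ sr ur]] := dir s u gs gu; exact: (tree_comparable tree sr ur).
Qed.

End SuslinForcing.

Theorem proposition1p6
  (dW : Order.disp_t) (W : orderType dW) (hW : is_omega1 W) :
  (exists (d : Order.disp_t) (T : porderType d), suslin_tree W T) ->
  exists (d : Order.disp_t) (T : bPOrderType d),
    suslin_tree W T /\ ~ stat_BN1 (T^d)%type hW.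
Proof.
move=> [d [T suslinT]].
have [x xinj] := suslin_nodes hW suslinT.
have [t statt] := stationary_cone hW suslinT xinj.
have suslinC : suslin_tree W (cone t).
  apply: (cone_suslin hW suslinT) => ct.
  apply: (stationary_uncountable hW (statt t (lexx t))).
  by apply: countable_preimage (in2W xinj) _ ct => _ [a ta <-].
exists d, (cone t); split=> // BN.
pose sigma := [set ap : W * ((cone t)^d)%type | val (ap.2 : cone t) = x ap.1].
have [a p q /= pa qa||g fg] := BN sigma; first by apply: val_inj; rewrite pa qa.
  apply: forces_stationary => [A|q C cC]; first exact: (suslin_ccc suslinC).
  have [a qa Ca] := statt (val (q : cone t)) (valP (q : cone t)) C cC.
  pose p : cone t := exist _ (x a) (le_trans (valP (q : cone t)) qa).
  by exists a => //; exists p => //; exists p; split; [exact: lexx|exact: qa].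
move=> /(stationary_uncountable hW); apply.
have cg := suslin_filter_countable hW suslinC fg.
apply: countable_preimage (in2W xinj) _ (countable_image (val : cone t -> T) cg).
by move=> _ [a [p gp pa] <-]; exists p.
Qed.
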